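(* Let $d<1$, $d\neq0$. Assume that: (U1) $A(s)$ is compact for every $s\in S$ and the correspondence $s\mapsto A(s)$ is upper semicontinuous; (U2) $u$ is upper semicontinuous on $\mathbb K$; (U3) $q$ is Feller, i.e. $(s,a)\mapsto\int_S v(s')q(ds'|s,a)$ is continuous on $\mathbb K$ for each bounded continuous $v:S\to\mathbb R$. Then there exists a unique solution $v^*\in\widehat{\mathcal U}$ to the Bellman equation $$v^*(s)=\max_{a\in A(s)}\left((1-\beta)u(s,a)^p+\beta[P(v^* )(s,a)]^p\right)^{1/p},\quad s\in S,\qquad P(v)(s,a):=\left(\int_S v(s')^d\,q(ds'|s,a)\right)^{1/d}.$$ If instead (C1) $A(s)$ is compact for every $s\in S$ and the correspondence $s\mapsto A(s)$ is continuous, (C2) $u$ is continuous on $\mathbb K$, and (C3)=(U3) hold, then $v^*\in\widehat{\mathcal C}$.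
   Context: Model. $S$ (states) and $A$ (actions) are Borel spaces, i.e. non-empty Borel subsets of complete separable metric spaces. $\mathbb K\subset S\times A$ is a non-empty Borel set such that each section $A(s)=\{a\in A:(s,a)\in\mathbb K\}$, $s\in S$, is non-empty. $q$ is a Borel measurable transition probability from $\mathbb K$ to $S$. $u:\mathbb K\to\mathbb R$ is Borel measurable with $b_0\le u(s,a)\le b_1$ for all $(s,a)\in\mathbb K$, where $b_1>b_0>0$ are constants. $\beta\in[0,1)$ and $p<1$, $p\ne0$ are fixed real parameters. Constants and classes. $0<\epsilon<B$ are fixed constants chosen as follows: if $p<0$, then $\epsilon\le b_0$ and $B\ge(1-\beta)^{1/p}b_1$; if $p\in(0,1)$, then $\epsilon\le(1-\beta)^{1/p}b_0$ and $B\ge b_1$. $\widehat{\mathcal U}$ (resp. $\widehat{\mathcal C}$) is the set of all upper semicontinuous (resp. continuous) functions $v:S\to[\epsilon,B]$. A correspondence $\varphi$ from $S$ to a separable metric space $Z$ is upper (lower) semicontinuous if $\{s\in S:\varphi(s)\cap D\ne\emptyset\}$ is closed (open) for each closed (open) $D\subset Z$, and continuous if both. *)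

(* Defs.v *)
From HB Require Import structures.
From mathcomp Require Import all_boot all_order all_algebra.
From mathcomp Require Import all_classical all_reals all_analysis.
From mathcomp Require Import measurable_realfun.
Set Implicit Arguments.
Unset Strict Implicit.
Unset Printing Implicit Defensive.
Import Order.TTheory GRing.Theory Num.Theory.
Import numFieldNormedType.Exports.
Local Open Scope classical_set_scope.
Local Open Scope ring_scope.

#[short(type="completeMetricType")]
HB.structure Definition CompleteMetric (R : numDomainType) :=
  {T of Complete T & Metric R T}.

Definition separable_space (T : topologicalType) :=
  exists2 D : set T, countable D & dense D.

Record borelSpace (R : realType) := BorelSpace {
  ambient : completeMetricType R ;
  carrier : set ambient ;
  ambient_separable : separable_space ambient ;
  carrier_nonempty : carrier !=set0 ;
  carrier_borel : <<s @open ambient >> carrier }.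

(* The points of a Borel space, with the metric (hence the topology) induced by
   the ambient space. The distinguished point only serves the library's
   convention that measurable types are pointed. *)
Definition points (R : realType) (S : borelSpace R) : Type :=
  set_type (@carrier R S).

Coercion points : borelSpace >-> Sortclass.

HB.instance Definition _ (R : realType) (S : borelSpace R) :=
  PseudoMetric.copy (points S) (set_type (@carrier R S)).

HB.instance Definition _ (R : realType) (S : borelSpace R) :=
  isPointed.Build (points S)
    (let x := cid (carrier_nonempty S) in
     SigSub (mem_set (svalP x)) : set_type (@carrier R S)).

(* On a product this is generated by the open sets of the product topology, not
   defined as the product sigma-algebra. *)
Notation borel T := (g_sigma_algebraType (@open T%type)).

(* Semicontinuity relative to D : set X is obtained at X := subspace D, as in
   the library's {within D, continuous f}. *)
Definition upper_semicontinuous (X : topologicalType) (R : realType)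
    (f : X -> R) :=
  forall x a, f x < a -> \forall y \near x, f y < a.

Definition usc_correspondence (S Z : topologicalType) (phi : S -> set Z) :=
  forall D : set Z, closed D -> closed [set s | phi s `&` D !=set0].

Definition lsc_correspondence (S Z : topologicalType) (phi : S -> set Z) :=
  forall D : set Z, open D -> open [set s | phi s `&` D !=set0].

Definition continuous_correspondence (S Z : topologicalType)
    (phi : S -> set Z) :=
  usc_correspondence phi /\ lsc_correspondence phi.

Definition is_max (R : realType) (E : set R) (m : R) := E m /\ ubound E m.

Section Bellman.
Context (R : realType) (S A : borelSpace R).

(* Functions on the graph K are represented by total functions on S * A whose
   values outside K are never used. *)
Implicit Types (K : set (S * A)) (q : S * A -> probability (borel S) R).
Implicit Types (u : S * A -> R) (v : S -> R).

Definition transition_probability K q :=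
  forall U : set (borel S), measurable U ->
    measurable_fun (K : set (borel (S * A))) (fun x => q x U).

Definition feller K q :=
  forall v, continuous v -> bounded_fun (v : S -> R^o) ->
    {within K, continuous (fun x => \int[q x]_s v s : R)}.

Definition certainty_equivalent q (d : R) v (x : S * A) : R :=
  (\int[q x]_s (v s `^ d)) `^ d^-1.

Definition bellman_solution K q u (beta p d : R) v :=
  forall s, is_max
    [set ((1 - beta) * u (s, a) `^ p
          + beta * certainty_equivalent q d v (s, a) `^ p) `^ p^-1
      | a in xsection K s]
    (v s).

Definition Uhat (eps B : R) v :=
  upper_semicontinuous v /\ forall s, eps <= v s <= B.

Definition Chat (eps B : R) v :=
  continuous v /\ forall s, eps <= v s <= B.

End Bellman.

(* Main.v *)
Require Import Defs.
From HB Require Import structures.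
From mathcomp Require Import all_boot all_order all_algebra.
From mathcomp Require Import all_classical all_reals all_analysis.
From mathcomp Require Import measurable_realfun.
From mathcomp Require Import ring lra.
Import Order.TTheory GRing.Theory Num.Theory.
Import numFieldNormedType.Exports.
Local Open Scope classical_set_scope.
Local Open Scope ring_scope.
Set Implicit Arguments.
Unset Strict Implicit.
Unset Printing Implicit Defensive.

(* The Bellman operator contracts ratios. The power mean P is monotone and
   homogeneous of degree 1, so v <= c w with c >= 1 gives P v <= c P w. Since u
   is bounded away from 0, (1 - beta) u^p is at least a fixed fraction delta of
   (1 - beta) u^p + beta (P w)^p, and therefore the images under the operator
   satisfy the same inequality with c replaced by c', where
   c'^p - 1 = (1 - delta) (c^p - 1); this formula is the same for both signs of
   p. Hence the iterates converge uniformly in ratio, and semicontinuity and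
   continuity pass to the limit. Upper semicontinuity is preserved by the
   operator because an upper semicontinuous v is a limit of Lipschitz majorants,
   whose power means are continuous by the Feller property and converge to P v
   from above, and by Berge's maximum theorem. *)

(** * Real powers with an exponent of either sign *)

Section Powers.
Context {R : realType}.
Implicit Types a b c p r x y : R.

Lemma powRK p x : p != 0 -> 0 <= x -> (x `^ p) `^ p^-1 = x.
Proof. by move=> p0 x0; rewrite -powRrM divff// powRr1. Qed.

Lemma powR_le_pos p x y : 0 <= p -> 0 < x -> x <= y -> x `^ p <= y `^ p.
Proof.
by move=> p0 x0 xy; apply: ge0_ler_powR => //; rewrite nnegrE; lra.
Qed.

Lemma powR_le_neg p x y : p <= 0 -> 0 < x -> x <= y -> y `^ p <= x `^ p.
Proof.
move=> p0 x0 xy; rewrite -[p]opprK (powRN x) (powRN y).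
by rewrite lef_pV2 ?posrE ?powR_gt0//; [apply: powR_le_pos => //; lra | lra].
Qed.

(** The power is monotone in [x], in a direction set by the sign of [p]; the minimum and the sum of
    the endpoint values serve both directions. *)
Lemma powR_between p a b x : 0 < a -> a <= x <= b ->
  Num.min (a `^ p) (b `^ p) <= x `^ p <= a `^ p + b `^ p.
Proof.
move=> a0 /andP[ax xb]; have x0 : 0 < x by lra.
have ap := powR_ge0 a p; have bp := powR_ge0 b p; rewrite ge_min.
have [p0|/ltW p0] := leP 0 p.
  have ha := powR_le_pos p0 a0 ax; have hb := powR_le_pos p0 x0 xb.
  by rewrite ha /=; lra.
have ha := powR_le_neg p0 a0 ax; have hb := powR_le_neg p0 x0 xb.
by rewrite hb orbT /=; lra.
Qed.

Lemma continuous_powR_pos p x : 0 < x -> {for x, continuous (fun y : R => y `^ p)}.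
Proof.
move=> x0; apply/differentiable_continuous/derivable1_diffP.
by apply: derivable_powR; rewrite in_itv/= x0.
Qed.

End Powers.

(** * The constant elasticity of substitution aggregator of utility and continuation value *)

Section CES.
Context {R : realType} (beta p : R).
Hypotheses (beta_ge0 : 0 <= beta) (beta_lt1 : beta < 1) (p_neq0 : p != 0).
Implicit Types u x c k delta : R.

Definition ces u x := ((1 - beta) * u `^ p + beta * x `^ p) `^ p^-1.

Lemma ces_base_gt0 u x : 0 < u -> 0 < (1 - beta) * u `^ p + beta * x `^ p.
Proof.
move: (beta_ge0) (beta_lt1) => bge0 blt1.
move=> u0; apply: ltr_pwDl; first by rewrite mulr_gt0 ?powR_gt0//; lra.
by rewrite mulr_ge0 ?powR_ge0//; lra.
Qed.

Lemma ces_diag x : 0 <= x -> ces x x = x.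
Proof.
move=> x0; rewrite /ces -mulrDl.
by rewrite subrK mul1r powRK.
Qed.

Lemma ces_le u u' x x' : 0 < u -> u <= u' -> 0 < x -> x <= x' ->
  ces u x <= ces u' x'.
Proof.
move: (beta_ge0) (beta_lt1) => bge0 blt1.
move=> u0 uu x0 xx; rewrite /ces.
have [p0|p0] : 0 < p \/ p < 0 by move: p_neq0; rewrite neq_lt => /orP[]; auto.
  apply: powR_le_pos; [by rewrite invr_ge0 ltW|exact: ces_base_gt0|].
  by apply: lerD; apply: ler_wpM2l; rewrite ?powR_le_pos//; lra.
apply: powR_le_neg; [by rewrite invr_le0 ltW|apply: ces_base_gt0; lra|].
by apply: lerD; apply: ler_wpM2l; rewrite ?powR_le_neg//; lra.
Qed.

(** One bound follows from monotonicity and [ces_diag], the other by dropping the term with [beta].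
    For [p > 0] these are the upper and the lower bound respectively; for [p < 0] the outer power
    reverses the order and they trade places. *)
Lemma ces_bounds b0 b1 eps B u x : 0 < b0 -> b0 <= u <= b1 ->
  0 < eps -> eps <= x <= B ->
  (p < 0 -> eps <= b0 /\ (1 - beta) `^ p^-1 * b1 <= B) ->
  (0 < p -> eps <= (1 - beta) `^ p^-1 * b0 /\ b1 <= B) ->
  eps <= ces u x <= B.
Proof.
move: (beta_ge0) (beta_lt1) => bge0 blt1.
move=> b00 /andP[bu ub] e0 /andP[ex xB] hneg hpos.
have u0 : 0 < u by lra.
have x0 : 0 < x by lra.
have E v : 0 < v -> (1 - beta) `^ p^-1 * v = ((1 - beta) * v `^ p) `^ p^-1.
  by move=> v0; rewrite powRM ?powR_ge0//; [rewrite powRK//; lra | lra].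
have bx : 0 <= beta * x `^ p by rewrite mulr_ge0 ?powR_ge0//; lra.
have [p0|p0] : 0 < p \/ p < 0 by move: p_neq0; rewrite neq_lt => /orP[]; auto.
- have [h1 h2] := hpos p0; apply/andP; split; last first.
    by rewrite -[leRHS]ces_diag; [apply: ces_le => //; lra | lra].
  apply: (le_trans h1); rewrite E//.
  apply: powR_le_pos.
  + by rewrite invr_ge0 ltW.
  + by rewrite mulr_gt0 ?powR_gt0//; lra.
  + apply: (@le_trans _ _ ((1 - beta) * u `^ p)); last lra.
    apply: ler_wpM2l; first lra.
    by apply: powR_le_pos => //; exact: ltW.
- have [h1 h2] := hneg p0; apply/andP; split.
    by rewrite -[leLHS]ces_diag; [apply: ces_le => //; lra | lra].
  apply: le_trans h2; apply: (@le_trans _ _ ((1 - beta) `^ p^-1 * u)).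
    rewrite E//; apply: powR_le_neg; first by rewrite invr_le0 ltW.
      by rewrite mulr_gt0 ?powR_gt0//; lra.
    lra.
  by apply: ler_wpM2l => //; exact: powR_ge0.
Qed.

(** With [w = (1 - beta) u^p], [y = x^p], [C = c^p] and [k = 1 + (1 - delta) (C - 1)], one has [k (w
    + beta y) - (w + beta C y) = (C - 1) (w - delta (w + beta y))]. The last factor is nonnegative
    by hypothesis, and [C - 1] has the sign that the outer power [p^-1] calls for. *)
Lemma ces_scale delta c u x : 0 < u -> 0 < x -> 1 <= c -> 0 <= delta <= 1 ->
  delta * ((1 - beta) * u `^ p + beta * x `^ p) <= (1 - beta) * u `^ p ->
  ces u (c * x) <= (1 + (1 - delta) * (c `^ p - 1)) `^ p^-1 * ces u x.
Proof.
move: (beta_ge0) (beta_lt1) => bge0 blt1.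
move=> u0 x0 c1 /andP[d0 d1] hd.
have cp0 : 0 < c `^ p by rewrite powR_gt0//; lra.
move: (ces_base_gt0 x u0) (@ces_base_gt0 u (c * x) u0) hd.
rewrite /ces powRM ?(ltW x0)//; last lra.
set y := x `^ p; set w := (1 - beta) * _; set C := c `^ p in cp0 *.
set k := 1 + _ => w0 wc0 hd.
(* [k = delta + (1 - delta) C] is a convex combination of [1] and [C > 0]. *)
have k0 : 0 < k by rewrite /k; nra.
have p1 : 1 `^ p = 1 :> R by rewrite powR1.
rewrite -powRM ?(ltW w0) ?(ltW k0)//.
have [p0|p0] : 0 < p \/ p < 0 by move: p_neq0; rewrite neq_lt => /orP[]; auto.
- have C1 : 1 <= C by rewrite -p1; apply: powR_le_pos => //; lra.
  apply: powR_le_pos => //; first by rewrite invr_ge0 ltW.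
  by rewrite /k; nra.
- have C1 : C <= 1 by rewrite -p1; apply: powR_le_neg => //; lra.
  apply: powR_le_neg; [by rewrite invr_le0 ltW|by rewrite mulr_gt0|].
  by rewrite /k; nra.
Qed.

(** Shifting both arguments at once reduces the semicontinuity of [ces] to a limit in one
    variable. *)
Lemma ces_shift_cvg u x : 0 < u -> 0 < x ->
  ces (u + e) (x + e) @[e --> 0] --> ces u x.
Proof.
move=> u0 x0; rewrite /ces.
have H (z : R) : 0 < z -> (z + e) `^ p @[e --> 0] --> z `^ p.
  move=> z0; apply: (@cvg_comp _ _ _ (fun e => z + e) (fun y => y `^ p) _
    (nbhs z)); last exact: continuous_powR_pos.
  have : z + e @[e --> 0] --> z + 0.
    by apply: cvgD; [exact: cvg_cst|exact: cvg_id].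
  by rewrite addr0.
apply: (@cvg_comp _ _ _
  (fun e => (1 - beta) * (u + e) `^ p + beta * (x + e) `^ p)
  (fun y => y `^ p^-1) _ (nbhs ((1 - beta) * u `^ p + beta * x `^ p))).
  by apply: cvgD; apply: cvgMr; exact: H.
exact/continuous_powR_pos/ces_base_gt0.
Qed.

End CES.

(* A Banach fixed point theorem for Thompson's metric, the sup norm of
   log v - log w; here c n bounds the ratio of the n-th iterates of any two functions. *)
Lemma thompson_fixpoint (R : realType) (T : Type) (C : set (T -> R))
    (F : (T -> R) -> T -> R) (c : R^nat) :
  C !=set0 ->
  (forall v s, C v -> 0 < v s) ->
  (forall n, 1 <= c n) -> c @ \oo --> (1 : R) ->
  (forall v w s, C v -> C w -> v s <= c 0%N * w s) ->
  (forall v, C v -> C (F v)) ->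
  (forall n v w, C v -> C w -> (forall s, v s <= c n * w s) ->
    forall s, F v s <= c n.+1 * F w s) ->
  (forall v, (forall n, exists2 w, C w &
      forall s, v s <= c n * w s /\ w s <= c n * v s) -> C v) ->
  exists v, [/\ C v, F v = v & forall w, C w -> F w = w -> w = v].
Proof.
move=> [v0 Cv0] Cpos c1 cvgc diamC FC Fcontr Cclosed.
have cc1 : (fun n => c n * c n) @ \oo --> (1 : R).
  by rewrite -[X in _ --> X]mulr1; apply: cvgM.
have squeeze x y : (forall n, x <= c n.+1 * c n.+1 * y) -> x <= y.
  move=> H; have ccy : (fun n => c n.+1 * c n.+1 * y) @ \oo --> y.
    rewrite -[X in _ --> X]mul1r; apply: cvgMl.
    by move: cc1; rewrite -cvg_shiftS.
  rewrite -(cvg_lim (@Rhausdorff R) ccy); apply: limr_ge.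
    by apply/cvg_ex; exists y.
  by near=> n; exact: H.
have uniq v w : C v -> C w -> F v = v -> F w = w -> forall s, v s <= w s.
  move=> Cv Cw Fv Fw s; apply: squeeze => n.
  (* Fixed points are their own images, so every application of [F] advances the modulus by one
     index. *)
  have H m : forall s, v s <= c m * w s.
    elim: m => [t|m IH t]; first exact: diamC.
    by rewrite -{1}Fv -{1}Fw; exact: Fcontr.
  apply: (le_trans (H n.+1 s)); have cn := c1 n.+1; have w0 := Cpos w s Cw.
  by rewrite -mulrA ler_peMl// mulr_ge0//; lra.
pose v n := iter n F v0.
have Cv n : C (v n) by elim: n => // n IH; exact: FC.
(* [v n] and [v (n + k)] are the [n]-th images of [v 0] and [v k], two members of [C]. *)
have vle n k s : v n s <= c n * v (n + k)%N s /\ v (n + k)%N s <= c n * v n s.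
  elim: n k s => [|n IH] k s; first by split; exact: diamC.
  by split; apply: Fcontr => // t; have [] := IH k t.
have vpos n s : 0 < v n s by exact: Cpos.
have cpos n : 0 < c n by have := c1 n; lra.
(* The least function above all v m / c m is the limit of the iterates. *)
pose E s := range (fun m => v m s / c m).
(* The earlier of the iterates [m] and [n] supplies the ratio bound; the other modulus is at least
   1. *)
have Eub n s : ubound (E s) (c n * v n s).
  move=> _ [m _ <-]; rewrite ler_pdivrMr//.
  have cm := c1 m; have cn := c1 n; have vn := vpos n s.
  have [mn|/ltnW nm] := leqP m n.
    have [h _] := vle m (n - m)%N s; rewrite subnKC// in h.
    by apply: (le_trans h); rewrite [leRHS]mulrC; apply: ler_wpM2l; nra.
  have [_ h] := vle n (m - n)%N s; rewrite subnKC// in h.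
  by apply: (le_trans h); rewrite ler_peMr//; nra.
have Esup s : has_sup (E s).
  by split; [exists (v 0%N s / c 0%N); exists 0%N|exists (c 0%N * v 0%N s)].
pose f s := sup (E s).
have fv n s : f s <= c n * v n s.
  by apply: sup_le_ub => //; exists (v 0%N s / c 0%N); exists 0%N.
have vf n s : v n s <= c n * f s.
  by rewrite mulrC -ler_pdivrMr//; apply: ub_le_sup; [case: (Esup s)|exists n].
have Cf : C f by apply: Cclosed => n; exists (v n).
have fpos s : 0 < f s by exact: Cpos.
have Ff : F f = f.
  (* Both [F f] and [f] are within ratio [c n.+1] of [v n.+1], hence within the square of it of each
     other. *)
  apply/funext => s; apply/le_anti/andP; split; apply: squeeze => n.
    have h : F f s <= c n.+1 * v n.+1 s by apply: Fcontr.
    have cn := cpos n.+1; have := vf n.+1 s; rewrite -(ler_pM2l cn) mulrA.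
    exact: le_trans.
  have h : v n.+1 s <= c n.+1 * F f s by apply: Fcontr.
  have cn := cpos n.+1; move: h; rewrite -(ler_pM2l cn) mulrA.
  exact: le_trans.
exists f; split => // w Cw Fw; apply/funext => s.
by apply/le_anti/andP; split; exact: uniq.
Unshelve. all: by end_near.
Qed.

(** * Semicontinuity, attained maxima and Berge's maximum theorem *)

Section Semicontinuity.
Context {R : realType}.

(** Points outside [K] are isolated in [subspace K], so the condition is vacuous there. *)
Lemma usc_subspaceP (X : topologicalType) (K : set X) (f : X -> R) :
  upper_semicontinuous (f : subspace K -> R) <->
  forall x a, K x -> f x < a -> \forall y \near x, K y -> f y < a.
Proof.
split=> [H x a Kx fxa|H x a fxa].
  have := H x a fxa; rewrite /prop_near1.
  by case: (nbhs_subspaceP K x) => // ->.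
rewrite /prop_near1; case: (nbhs_subspaceP K x) => Kx.
  exact: H.
by move=> y ->.
Qed.

Lemma usc_lsc_continuous (X : topologicalType) (f : X -> R) :
  upper_semicontinuous f ->
  (forall x a, a < f x -> \forall y \near x, a < f y) -> continuous f.
Proof.
move=> usc lsc x; apply/cvgrPdist_lt => e e0; near=> y.
have h1 : f y < f x + e by near: y; apply: usc; lra.
have h2 : f x - e < f y by near: y; apply: lsc; lra.
by rewrite ltr_norml; lra.
Unshelve. all: by end_near.
Qed.

(** If the supremum [M] were not attained, [f] would stay below [M] by a positive margin near each
    point; compactness makes one margin [e] work on all of [A], and [M - e] would be an upper
    bound. *)
Lemma usc_compact_max (Y : topologicalType) (A : set Y) (f : Y -> R) (B : R) :
  compact A -> A !=set0 -> (forall x, A x -> f x <= B) ->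
  (forall x a, A x -> f x < a -> \forall y \near x, A y -> f y < a) ->
  exists2 x, A x & forall y, A y -> f y <= f x.
Proof.
move=> /compact_near_coveringP cA [x0 Ax0] fB usc.
have fsup : has_sup (f @` A).
  by split; [exists (f x0), x0 | exists B => _ [y Ay <-]; exact: fB].
set M := sup (f @` A).
have fM y : A y -> f y <= M by move=> Ay; apply: ub_le_sup; [case: fsup|exists y].
apply: contrapT => nomax.
have ltM x : A x -> f x < M.
  move=> Ax; rewrite lt_neqAle fM// andbT; apply/eqP => fxM; apply: nomax.
  by exists x => // y Ay; rewrite fxM; exact: fM.
have : \forall e \near 0^'+, A `<=` (fun y => A y -> f y <= M - e).
  apply: cA => x Ax; have xM := ltM x Ax.
  exists ([set y | A y -> f y < (f x + M) / 2], [set e | e < (M - f x) / 2]).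
    by split; [apply: usc => //; lra | apply: nbhs_right_lt; lra].
  by move=> [y e] /= [h1 h2] Ay; have := h1 Ay; lra.
move=> /(filterI (nbhs_right_gt 0)) /filter_ex[e [e0 he]].
have : M <= M - e.
  by apply: sup_le_ub; [exists (f x0), x0|move=> _ [y Ay <-]; exact: he].
lra.
Unshelve. all: by end_near.
Qed.

(** A tube argument over the compact section at [s] gives a radius [e] and an open [W] containing
    that section such that [f < c] on the part of [K] over the ball and [W]. Upper semicontinuity of
    the correspondence keeps nearby sections inside [W]. *)
Lemma maximum_usc (X : pseudoMetricType R) (Y : topologicalType)
    (K : set (X * Y)) (f : X * Y -> R) (V : X -> R) :
  (forall s, compact (xsection K s)) -> usc_correspondence (xsection K) ->
  upper_semicontinuous (f : subspace K -> R) ->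
  (forall s, is_max [set f (s, a) | a in xsection K s] (V s)) ->
  upper_semicontinuous V.
Proof.
move=> cK uK /usc_subspaceP uf maxV s c Vc.
pose P (e : R) (a : Y) := forall s', ball s e s' -> K (s', a) -> f (s', a) < c.
have : \forall e \near 0^'+, xsection K s `<=` (fun a => \forall a' \near a, P e a').
  move/compact_near_coveringP: (cK s); apply => a Ka.
  have Ksa : K (s, a) by move: Ka; rewrite /xsection/= inE.
  have : f (s, a) < c.
    by apply: le_lt_trans Vc; have [_ ub] := maxV s; apply: ub; exists a.
  move=> /(uf _ _ Ksa)[[U W] /= [/nbhs_ballP[r /= r0 rU] aW] UW].
  exists (nbhs^~ W, [set e | e < r]) => /=.
    by split; [exact: nbhs_interior|exact: nbhs_right_lt].
  move=> [a' e] /= [Wa' er]; apply: filterS Wa' => b Wb s' ss' Kb.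
  apply: (UW (s', b)) => //; split => //=; apply: rU.
  by apply: le_ball ss'; exact: ltW.
move=> /(filterI (nbhs_right_gt 0)) /filter_ex[e [/= e0 he]].
pose W := interior [set a | P e a].
have Wc : closed [set s' | xsection K s' `&` ~` W !=set0].
  by apply: uK; exact/open_closedC/open_interior.
have nbW : \forall s' \near s, ~ (xsection K s' `&` ~` W !=set0).
  apply: open_nbhs_nbhs; split; first exact: closed_openC.
  by move=> [a [Ka /= nW]]; apply: nW; exact: he.
near=> s'.
have ss' : ball s e s' by near: s'; exact: nbhsx_ballx.
have sW : ~ (xsection K s' `&` ~` W !=set0) by near: s'.
have [[a Ka <-] _] := maxV s'.
have Wa : W a by apply: contrapT => nW; apply: sW; exists a.
apply: (interior_subset Wa) => //.
by move: Ka; rewrite /xsection/= inE.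
Unshelve. all: by end_near.
Qed.

(** Sections near [s] contain actions close to a maximizer at [s], and the values of [f] there
    already exceed [c]. *)
Lemma maximum_lsc (X Y : topologicalType) (K : set (X * Y)) (f : X * Y -> R)
    (V : X -> R) :
  lsc_correspondence (xsection K) ->
  (forall x c, K x -> c < f x -> \forall y \near x, K y -> c < f y) ->
  (forall s, is_max [set f (s, a) | a in xsection K s] (V s)) ->
  forall s c, c < V s -> \forall s' \near s, c < V s'.
Proof.
move=> lK lf maxV s c.
have [[a Ka <-] _] := maxV s => cf.
have Ksa : K (s, a) by move: Ka; rewrite /xsection/= inE.
have [[U W] /= [sU aW] UW] := lf _ _ Ksa cf.
have nbW : \forall s' \near s, xsection K s' `&` interior W !=set0.
  apply: open_nbhs_nbhs; split; first exact/lK/open_interior.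
  by exists a.
near=> s'.
have Us' : U s' by near: s'.
have [b [Kb /interior_subset Wb]] : xsection K s' `&` interior W !=set0.
  by near: s'.
have Ksb : K (s', b) by move: Kb; rewrite /xsection/= inE.
have [_ ub] := maxV s'.
apply: (@lt_le_trans _ _ (f (s', b))); first exact: (UW (s', b)).
by apply: ub; exists b.
Unshelve. all: by end_near.
Qed.

End Semicontinuity.

(** * Power means under a probability measure *)

Section PowerMean.
Context {R : realType} {disp : measure_display} {T : measurableType disp}.
Context (mu : probability T R) (d eps B : R).
Hypotheses (d_neq0 : d != 0) (eps_gt0 : 0 < eps).
Implicit Types v w : T -> R.

Definition power_mean v : R := (\int[mu]_s (v s `^ d)) `^ d^-1.

Let between v := measurable_fun setT v /\ forall s, eps <= v s <= B.

Let between_gt0 v s : between v -> 0 < v s.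
Proof. by move=> [_ /(_ s)/andP[+ _]]; exact: lt_le_trans. Qed.

Lemma integrable_powR v : between v ->
  mu.-integrable setT (EFin \o (fun s => v s `^ d)).
Proof.
move=> [mv vb]; apply: measurable_bounded_integrable => //.
- by rewrite (@le_lt_trans _ _ 1%E)//= ?probability_le1// ltry.
- exact: (@measurableT_comp _ _ _ _ _ _ (@powR R ^~ d)).
- exists (eps `^ d + B `^ d); split; first exact: num_real.
  move=> M hM s _; have := powR_between d eps_gt0 (vb s).
  by rewrite /= ger0_norm ?powR_ge0//; lra.
Qed.

Lemma power_mean_cst (a : R) : 0 <= a -> power_mean (cst a) = a.
Proof.
move=> a0; rewrite /power_mean.
rewrite (_ : (fun s => _) = cst (a `^ d))//.
rewrite Rintegral_cst// -[X in _ * X]/(fine (mu setT)) probability_setT/= mulr1.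
exact: powRK.
Qed.

(** Positivity makes the outer power [d^-1] monotone and continuous at the integral. It holds
    because the integrand is at least the smaller endpoint power and the mass is 1. *)
Lemma Rintegral_powR_gt0 v : between v -> 0 < \int[mu]_s (v s `^ d).
Proof.
move=> bv; have [mv vb] := bv; have epsB : eps <= B.
  by have /andP[] := vb point; exact: le_trans.
apply: (@lt_le_trans _ _ (Num.min (eps `^ d) (B `^ d))).
  by rewrite lt_min !powR_gt0//; exact: lt_le_trans epsB.
rewrite -[leLHS]mulr1 -[X in _ * X]/(fine 1%E) -(@probability_setT _ _ _ mu).
rewrite -Rintegral_cst//.
apply: le_Rintegral => //.
- exact: finite_measure_integrable_cst.
- exact: integrable_powR.
- by move=> s _; have /andP[] := powR_between d eps_gt0 (vb s).
Qed.

Lemma power_mean_le v w : between v -> between w -> (forall s, v s <= w s) ->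
  power_mean v <= power_mean w.
Proof.
move=> bv bw vw; rewrite /power_mean.
have v0 s : 0 < v s by exact: between_gt0.
have iv := integrable_powR bv; have iw := integrable_powR bw.
have [d0|d0] : 0 < d \/ d < 0 by move: d_neq0; rewrite neq_lt => /orP[]; auto.
  apply: powR_le_pos; [by rewrite invr_ge0 ltW|exact: Rintegral_powR_gt0|].
  by apply: le_Rintegral => // s _; apply: powR_le_pos => //; exact: ltW.
apply: powR_le_neg; [by rewrite invr_le0 ltW|exact: Rintegral_powR_gt0|].
by apply: le_Rintegral => // s _; apply: powR_le_neg => //; exact: ltW.
Qed.

Lemma power_mean_between v : between v -> eps <= power_mean v <= B.
Proof.
move=> bv; have [mv vb] := bv; have epsB : eps <= B.
  by have /andP[] := vb point; exact: le_trans.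
have B0 : 0 <= B by exact: le_trans (ltW eps_gt0) epsB.
rewrite -{1}(power_mean_cst (ltW eps_gt0)) -{1}(power_mean_cst B0).
have bcst (a : R) : eps <= a <= B -> between (cst a) by split.
apply/andP; split; apply: power_mean_le => //.
- by apply: bcst; lra.
- by move=> s; have /andP[] := vb s.
- by apply: bcst; lra.
- by move=> s; have /andP[] := vb s.
Qed.

Lemma power_meanZ (c : R) v : between v -> 0 <= c ->
  power_mean (fun s => c * v s) = c * power_mean v.
Proof.
move=> bv c0; have [_ vb] := bv; rewrite /power_mean.
have -> : (fun s => (c * v s) `^ d) = (fun s => c `^ d * v s `^ d).
  by apply/funext => s; rewrite powRM//; exact/ltW/between_gt0.
rewrite RintegralZl//; last exact: integrable_powR.
rewrite powRM ?powR_ge0//; first by rewrite powRK.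
exact/ltW/Rintegral_powR_gt0.
Qed.

(** Dominated convergence; the constant [eps^d + B^d] dominates for either sign of [d]. *)
Lemma power_mean_cvg (h : (T -> R)^nat) v : (forall n, between (h n)) ->
  between v -> (forall s, h ^~ s @ \oo --> v s) ->
  power_mean (h n) @[n --> \oo] --> power_mean v.
Proof.
move=> bh bv hv; rewrite /power_mean.
have v0 s : 0 < v s by exact: between_gt0.
have I0 := Rintegral_powR_gt0 bv.
apply: (@cvg_comp _ _ _ (fun n => \int[mu]_s (h n s `^ d)) (fun y => y `^ d^-1) _
  (nbhs (\int[mu]_s (v s `^ d)))); last exact: continuous_powR_pos.
have mp w : between w -> measurable_fun setT (EFin \o (fun s => w s `^ d)).
  by move=> /integrable_powR /integrableP[].
have [|||||_ _ cvgI] := @dominated_convergence _ T R mu setT measurableT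
    (fun n => EFin \o (fun s => h n s `^ d)) (EFin \o (fun s => v s `^ d))
    (cst (eps `^ d + B `^ d)%:E).
- by move=> n; exact: mp.
- exact: mp.
- apply: aeW => s _; apply: cvg_EFin; first exact: nearW.
  by apply: (@cvg_comp _ _ _ (h ^~ s) (fun y => y `^ d) _ (nbhs (v s)));
    [exact: hv|exact: continuous_powR_pos].
- exact: finite_measure_integrable_cst.
- apply: aeW => s n _; rewrite /= lee_fin ger0_norm ?powR_ge0//.
  by have [_ /(_ s) hb] := bh n; have /andP[] := powR_between d eps_gt0 hb.
apply: fine_cvg; rewrite fineK//.
apply: integrable_fin_num => //; exact: integrable_powR.
Qed.

End PowerMean.

(** * Approximation of upper semicontinuous functions from above *)

Section BaireApproximation.
Context {R : realType}.

Lemma usc_measurable (T : ptopologicalType) (f : T -> R) :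
  upper_semicontinuous f -> measurable_fun setT (f : borel T -> R).
Proof.
move=> usc; apply: (measurability _ (RGenInftyO.measurableE R)).
move=> /= _ [_ [a ->]] <-; rewrite setTI preimage_itvNyo.
apply: sub_sigma_algebra => /=.
by rewrite openE => x /= fxa; exact: usc.
Qed.

(** Supplies the real-valued distance from which the Lipschitz envelopes are built. *)
Lemma points_ballE (S : borelSpace R) (x y : S) (e : R) :
  ball x e y <-> mdist (set_val x) (set_val y) < e.
Proof.
have -> : ball x e y = ball (set_val x) e (set_val y) by [].
by rewrite ballEmdist.
Qed.

(* Pasch-Hausdorff envelopes: [h k] is the least [k]-Lipschitz majorant. *)
Lemma usc_lipschitz_approx (S : pseudoMetricType R) (M : metricType R)
    (g : S -> M) (v : S -> R) (a b : R) :
  (forall x y e, ball x e y <-> mdist (g x) (g y) < e) ->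
  upper_semicontinuous v -> (forall s, a <= v s <= b) ->
  exists h : (S -> R)^nat, [/\ forall k, continuous (h k),
    forall k s, v s <= h k s <= b & forall s, h ^~ s @ \oo --> v s].
Proof.
move=> gE usc vab.
pose dist (s t : S) := mdist (g s) (g t).
have distC s t : dist s t = dist t s by exact: metric_sym.
have distD s t r : dist s r <= dist s t + dist t r by exact: metric_triangle.
have dist_ge0 s t : 0 <= dist s t by exact: mdist_ge0.
have distxx s : dist s s = 0 by exact: mdistxx.
pose E k s := range (fun t => v t - k%:R * dist s t).
pose h k s := sup (E k s).
have ub k s : ubound (E k s) b.
  move=> _ [t _ <-]; have := vab t; have := mulr_ge0 (ler0n R k) (dist_ge0 s t).
  lra.
have E0 k s : E k s !=set0 by exists (v s - k%:R * dist s s), s.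
have hE k s t : v t - k%:R * dist s t <= h k s.
  by apply: ub_le_sup; [exists b; exact: ub|exists t].
have vh k s : v s <= h k s.
  by have := hE k s s; rewrite distxx mulr0 subr0.
have lip k s t : h k s <= h k t + k%:R * dist s t.
  apply: sup_le_ub => // _ [r _ <-]; have := hE k t r.
  have := ler_wpM2l (ler0n R k) (distD t s r); rewrite mulrDr (distC t s).
  lra.
exists h; split.
- move=> k s; apply/cvgrPdist_lt => e e0.
  (* Adding 1 keeps the radius meaningful for [k = 0]. *)
  have k0 : 0 < k%:R + 1 :> R by rewrite ltr_wpDl.
  near=> t.
  have st : dist s t < e / (k%:R + 1).
    by apply/gE; near: t; apply: nbhsx_ballx; exact: divr_gt0.
  rewrite ltr_pdivlMr// mulrDr mulr1 mulrC in st.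
  have := lip k s t; have := lip k t s; rewrite (distC t s).
  by have := dist_ge0 s t; rewrite ltr_norml; lra.
- by move=> k s; rewrite vh/=; apply: sup_le_ub => //; exact: ub.
- move=> s; apply/cvgrPdist_lt => e e0.
  have /nbhs_ballP[r /= r0 rv] : \forall t \near s, v t < v s + e / 2.
    by apply: usc; lra.
  near=> k.
  have hk : h k s <= v s + e / 2.
    apply: sup_le_ub => // _ [t _ <-].
    (* Within [r] of [s] semicontinuity bounds [v t]; farther away the penalty is at least
       [k r >= b - v s], which brings the term below [v s]. *)
    have [st|st] := ltP (dist s t) r.
      have := mulr_ge0 (ler0n R k) (dist_ge0 s t).
      have /= := rv t ((gE _ _ _).2 st).
      lra.
    have kb : (b - v s) / r <= k%:R.
      near: k; exact: nbhs_infty_ger.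
    rewrite ler_pdivrMr// in kb.
    have := ler_wpM2l (ler0n R k) st; have := vab t; lra.
  by have := vh k s; rewrite ltr_norml; lra.
Unshelve. all: by end_near.
Qed.

End BaireApproximation.

(** * Ratio moduli and semicontinuity of limits in ratio *)

Section Moduli.
Context {R : realType}.

(** In the variable [c^p - 1] the recursion is multiplication by [kappa], so it is solved by a
    geometric sequence. *)
Lemma contraction_moduli (p kappa c0 : R) :
  p != 0 -> 0 <= kappa < 1 -> 1 <= c0 ->
  exists c : R^nat, [/\ c 0%N = c0, forall n, 1 <= c n, c @ \oo --> (1 : R) &
    forall n, c n.+1 = (1 + kappa * (c n `^ p - 1)) `^ p^-1].
Proof.
move=> p0 /andP[k0 k1] c01; have C0 : 0 < c0 `^ p by rewrite powR_gt0//; lra.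
pose b n := 1 + kappa ^+ n * (c0 `^ p - 1).
have k01 n : 0 <= kappa ^+ n <= 1 by rewrite exprn_ge0//= exprn_ile1//; exact: ltW.
have b0 n : 0 < b n by rewrite /b; have /andP[h1 h2] := k01 n; nra.
have E1 r : 1 `^ r = 1 :> R by rewrite powR1.
exists (fun n => b n `^ p^-1); split.
- by rewrite /b expr0 mul1r addrC subrK powRK//; lra.
- move=> n; have /andP[h1 h2] := k01 n; rewrite -(E1 p^-1).
  have [p_gt0|p_lt0] : 0 < p \/ p < 0 by move: p0; rewrite neq_lt => /orP[]; auto.
    have : 1 `^ p <= c0 `^ p by apply: powR_le_pos => //; exact: ltW.
    rewrite E1 => C1; apply: powR_le_pos => //; first by rewrite invr_ge0 ltW.
    by rewrite /b; nra.
  have : c0 `^ p <= 1 `^ p by apply: powR_le_neg => //; exact: ltW.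
  rewrite E1 => C1; apply: powR_le_neg => //; first by rewrite invr_le0 ltW.
  by rewrite /b; nra.
- rewrite -(E1 p^-1).
  apply: (@cvg_comp _ _ _ b (fun y => y `^ p^-1) _ (nbhs (1 : R))).
    have : b @ \oo --> 1 + 0 * (c0 `^ p - 1).
      apply: cvgD; first exact: cvg_cst.
      by apply: cvgMl; apply: cvg_expr; rewrite ger0_norm.
    by rewrite mul0r addr0.
  exact: continuous_powR_pos.
- move=> n; congr (_ `^ _); rewrite powRAC powRK//; last exact: ltW.
  by rewrite /b exprS; ring.
Qed.

Lemma cvg_sqr_scale (c : R^nat) (x : R) : c @ \oo --> (1 : R) ->
  c n * (c n * x) @[n --> \oo] --> x.
Proof.
move=> c1; have : c n * (c n * x) @[n --> \oo] --> 1 * (1 * x).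
  by apply: cvgM => //; apply: cvgM => //; exact: cvg_cst.
by rewrite !mul1r.
Qed.

Context (X : topologicalType) (c : R^nat).
Hypotheses (c_ge1 : forall n, 1 <= c n) (c_cvg1 : c @ \oo --> (1 : R)).
Implicit Types v w : X -> R.

(** Passing from [v] to an approximant and back costs a factor [c n] each way; [n] is chosen so that
    [c n * (c n * v x)] is still below [a]. *)
Lemma usc_ratio_limit v :
  (forall n, exists2 w, upper_semicontinuous w &
    forall s, v s <= c n * w s /\ w s <= c n * v s) ->
  upper_semicontinuous v.
Proof.
move=> H x a vxa.
have /filter_ex[n na] : \forall n \near \oo, c n * (c n * v x) < a.
  by have /cvgr_lt := cvg_sqr_scale (x := v x) c_cvg1; exact.
have cn : 0 < c n by exact: lt_le_trans (c_ge1 n).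
have [w uw vw] := H n.
have wxa : w x < (c n)^-1 * a.
  rewrite -(ltr_pM2l cn) mulVKf ?gt_eqF//.
  by apply: le_lt_trans na; rewrite ler_pM2l//; have [] := vw x.
have := uw _ _ wxa; apply: filterS => y wya.
have [h _] := vw y; apply: le_lt_trans h _.
by move: wya; rewrite -(ltr_pM2l cn) mulVKf ?gt_eqF.
Qed.

Lemma lsc_ratio_limit v :
  (forall n, exists2 w : X -> R, (forall x a, a < w x -> \forall y \near x, a < w y) &
    forall s, v s <= c n * w s /\ w s <= c n * v s) ->
  forall x a, a < v x -> \forall y \near x, a < v y.
Proof.
move=> H x a avx.
have /filter_ex[n na] : \forall n \near \oo, c n * (c n * a) < v x.
  by have /cvgr_lt := cvg_sqr_scale (x := a) c_cvg1; exact.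
have cn : 0 < c n by exact: lt_le_trans (c_ge1 n).
have [w lw vw] := H n.
have awx : c n * a < w x.
  by rewrite -(ltr_pM2l cn); apply: (lt_le_trans na); have [] := vw x.
have := lw _ _ awx; apply: filterS => y awy.
by have [_ h] := vw y; rewrite -(ltr_pM2l cn); exact: lt_le_trans h.
Qed.

End Moduli.

(** * The share of current utility, and semicontinuity of the aggregator *)

Section CESSemicontinuity.
Context {R : realType} (beta p : R).
Hypotheses (beta_ge0 : 0 <= beta) (beta_lt1 : beta < 1) (p_neq0 : p != 0).

Lemma ces_share b0 b1 eps B : 0 < b0 -> 0 < eps ->
  b0 <= b1 -> eps <= B ->
  exists2 delta, 0 < delta <= 1 & forall u x, b0 <= u <= b1 -> eps <= x <= B ->
    delta * ((1 - beta) * u `^ p + beta * x `^ p) <= (1 - beta) * u `^ p.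
Proof.
move: (beta_ge0) (beta_lt1) => bge0 blt1 b00 e0 b01 eB.
set m := Num.min (b0 `^ p) (b1 `^ p).
pose N := b0 `^ p + b1 `^ p + (eps `^ p + B `^ p).
have m0 : 0 < m by rewrite lt_min !powR_gt0//; lra.
have mb0 : m <= b0 `^ p by rewrite ge_min lexx.
have b1p := powR_ge0 b1 p; have ep := powR_ge0 eps p; have Bp := powR_ge0 B p.
have N0 : 0 < N by rewrite /N; lra.
(* [m] bounds [u^p] from below and [N] bounds [u^p + x^p] from above; the factor [1 - beta] cancels
   against the one on the right. *)
exists ((1 - beta) * m / N).
  by rewrite divr_gt0 ?mulr_gt0//=; [rewrite ler_pdivrMr// /N; nra|lra].
move=> u x hu hx; have /andP[h1 h2] := powR_between p b00 hu.
have /andP[_ h3] := powR_between p e0 hx.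
have up := powR_ge0 u p; have xp := powR_ge0 x p.
rewrite -2!mulrA ler_pM2l; last lra.
apply: le_trans h1; rewrite -mulrA -/m ger_pMr// mulrC ler_pdivrMr// mul1r /N.
by nra.
Qed.

Context (X : topologicalType) (K : set X) (f g : X -> R).
Hypotheses (f_gt0 : forall x, K x -> 0 < f x) (g_gt0 : forall x, K x -> 0 < g x).

(** A small upward shift of both arguments keeps the value below [a], and by monotonicity the
    shifted value bounds all nearby ones. *)
Lemma ces_usc :
  (forall x a, K x -> f x < a -> \forall y \near x, K y -> f y < a) ->
  (forall x a, K x -> g x < a -> \forall y \near x, K y -> g y < a) ->
  forall x a, K x -> ces beta p (f x) (g x) < a ->
    \forall y \near x, K y -> ces beta p (f y) (g y) < a.
Proof.
move=> uf ug x a Kx fga.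
have : \forall e \near (0 : R), ces beta p (f x + e) (g x + e) < a.
  exact: (cvgr_lt _ (ces_shift_cvg (p := p) beta_ge0 beta_lt1 (f_gt0 Kx) (g_gt0 Kx))).
move=> /nbhs_ballP[r /= r0 rP].
have : ces beta p (f x + r / 2) (g x + r / 2) < a.
  by apply: rP; rewrite /ball/= sub0r normrN ger0_norm; lra.
have fr : f x < f x + r / 2 by rewrite ltrDl divr_gt0.
have gr : g x < g x + r / 2 by rewrite ltrDl divr_gt0.
move=> ra.
apply: filterS2 (uf _ _ Kx fr) (ug _ _ Kx gr) => y hf hg Ky.
have f0 := f_gt0 Ky; have g0 := g_gt0 Ky.
have h1 := ltW (hf Ky); have h2 := ltW (hg Ky).
by apply: le_lt_trans ra; exact: ces_le.
Qed.

Lemma ces_lsc :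
  (forall x a, K x -> a < f x -> \forall y \near x, K y -> a < f y) ->
  (forall x a, K x -> a < g x -> \forall y \near x, K y -> a < g y) ->
  forall x a, K x -> a < ces beta p (f x) (g x) ->
    \forall y \near x, K y -> a < ces beta p (f y) (g y).
Proof.
move=> lf lg x a Kx fga; have fx := f_gt0 Kx; have gx := g_gt0 Kx.
have : \forall e \near (0 : R), a < ces beta p (f x + e) (g x + e).
  exact: (cvgr_gt _ (ces_shift_cvg (p := p) beta_ge0 beta_lt1 fx gx)).
move=> /nbhs_ballP[r /= r0 rP].
(* The shift stays below [f x] and [g x], so the lowered arguments remain positive and [ces_le]
   applies. *)
pose e := Num.min r (Num.min (f x) (g x)) / 2.
have e0 : 0 < e by rewrite divr_gt0// !lt_min r0 fx gx.
have [er [ef eg]] : e < r /\ e < f x /\ e < g x.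
  have : Num.min r (Num.min (f x) (g x)) <= r by rewrite ge_min lexx.
  have : Num.min r (Num.min (f x) (g x)) <= f x by rewrite !ge_min lexx orbT.
  have : Num.min r (Num.min (f x) (g x)) <= g x by rewrite !ge_min lexx !orbT.
  by rewrite /e; lra.
clearbody e; have : a < ces beta p (f x - e) (g x - e).
  by apply: rP; rewrite /ball/= sub0r opprK ger0_norm; lra.
move=> ra.
have fe : f x - e < f x by rewrite gtrBl.
have ge : g x - e < g x by rewrite gtrBl.
apply: filterS2 (lf _ _ Kx fe) (lg _ _ Kx ge) => y hf hg Ky.
have h1 := hf Ky; have h2 := hg Ky.
by apply: (lt_le_trans ra); apply: ces_le; rewrite ?subr_gt0//; exact: ltW.
Qed.

End CESSemicontinuity.

(** * The Bellman operator: attained maxima, invariant classes, contraction *)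

Definition aggregator (R : realType) (S A : borelSpace R)
    (q : S * A -> probability (borel S) R) (u : S * A -> R) (beta p d : R)
    (v : S -> R) (x : S * A) : R :=
  ces beta p (u x) (certainty_equivalent q d v x).

(** A supremum, hence a total function of [v]; [bellman_max] shows that it is attained when [v] is
    in [Uhat]. *)
Definition bellman_operator (R : realType) (S A : borelSpace R)
    (K : set (S * A)) (q : S * A -> probability (borel S) R) (u : S * A -> R)
    (beta p d : R) (v : S -> R) (s : S) : R :=
  sup [set aggregator q u beta p d v (s, a) | a in xsection K s].

Section BellmanOperator.
Context (R : realType) (S A : borelSpace R) (K : set (S * A)).
Context (q : S * A -> probability (borel S) R) (u : S * A -> R).
Context (b0 b1 beta p eps B d : R).
Hypotheses (K_sections : forall s : S, xsection K s !=set0)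
  (b0_gt0 : 0 < b0) (b0_le_b1 : b0 <= b1)
  (u_bounds : forall x, K x -> b0 <= u x <= b1)
  (beta_ge0 : 0 <= beta) (beta_lt1 : beta < 1) (p_neq0 : p != 0)
  (eps_gt0 : 0 < eps) (eps_le_B : eps <= B)
  (eps_B_neg : p < 0 -> eps <= b0 /\ (1 - beta) `^ p^-1 * b1 <= B)
  (eps_B_pos : 0 < p -> eps <= (1 - beta) `^ p^-1 * b0 /\ b1 <= B)
  (d_neq0 : d != 0)
  (K_compact : forall s : S, compact (xsection K s))
  (K_usc : usc_correspondence (xsection K))
  (u_usc : upper_semicontinuous (u : subspace K -> R))
  (q_feller : feller K q).
Implicit Types v w : S -> R.

Local Notation ce := (certainty_equivalent q d).
Local Notation agg := (aggregator q u beta p d).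
Local Notation bellman := (bellman_operator K q u beta p d).

Let Uhat_between v : Uhat eps B v ->
  measurable_fun setT (v : borel S -> R) /\ forall s, eps <= v s <= B.
Proof. by move=> [uv vb]; split=> //; exact: usc_measurable. Qed.

Let ce_between v x : Uhat eps B v -> eps <= ce v x <= B.
Proof. by move=> /Uhat_between; exact: power_mean_between. Qed.

Let ce_gt0 v x : Uhat eps B v -> 0 < ce v x.
Proof. by move=> /(ce_between x)/andP[+ _]; exact: lt_le_trans. Qed.

Let u_gt0 x : K x -> 0 < u x.
Proof. by move=> /u_bounds/andP[+ _]; exact: lt_le_trans. Qed.

Lemma Chat_Uhat v : Chat eps B v -> Uhat eps B v.
Proof.
move=> [cv vb]; split=> // x a vxa.
by have /cvgr_lt := cv x; exact.
Qed.

(** Since [v] stays in [[eps, B]] with [eps > 0], its power is bounded and continuous for either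
    sign of [d], so the Feller property applies. *)
Lemma certainty_equivalent_continuous v : Chat eps B v ->
  {within K, continuous (certainty_equivalent q d v)}.
Proof.
move=> Cv; have Uv := Chat_Uhat Cv; have [cv vb] := Cv.
have v0 s : 0 < v s by have /andP[+ _] := vb s; exact: lt_le_trans.
have cvd : continuous (fun s => v s `^ d).
  move=> s; apply: (@cvg_comp _ _ _ v (fun y => y `^ d) _ (nbhs (v s))).
    exact: cv.
  exact: continuous_powR_pos.
have bvd : bounded_fun ((fun s => v s `^ d) : S -> R^o).
  exists (eps `^ d + B `^ d); split; first exact: num_real.
  move=> M hM s _; have := powR_between d eps_gt0 (vb s).
  by rewrite /= ger0_norm ?powR_ge0//; lra.
have := q_feller cvd bvd; rewrite 2!subspace_continuousP => H x Kx.
apply: (@cvg_comp _ _ _ (fun x => \int[q x]_s (v s `^ d)) (fun y => y `^ d^-1)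
  _ (nbhs (\int[q x]_s (v s `^ d)))).
  exact: H.
apply: continuous_powR_pos.
exact: (Rintegral_powR_gt0 (q x) d eps_gt0 (Uhat_between Uv)).
Qed.

(** One Lipschitz majorant whose certainty equivalent at [x] is below [a] suffices: that equivalent
    is continuous on [K] and dominates the one of [v]. *)
Let ce_usc v : Uhat eps B v -> forall x a, K x -> ce v x < a ->
  \forall y \near x, K y -> ce v y < a.
Proof.
move=> Uv x a Kx vxa; have [uv vb] := Uv.
have [h [ch vhB hv]] := usc_lipschitz_approx (@points_ballE R S) uv vb.
have Ch n : Chat eps B (h n).
  split=> // s; have /andP[e1 _] := vb s; have /andP[e2 ->] := vhB n s.
  by rewrite (le_trans e1 e2).
have /filter_ex[n na] : \forall n \near \oo, ce (h n) x < a.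
  have cvgh : ce (h n) x @[n --> \oo] --> ce v x.
    apply: (power_mean_cvg eps_gt0 _ (Uhat_between Uv) hv) => n.
    exact/Uhat_between/Chat_Uhat.
  by move/cvgr_lt: cvgh; exact.
have := certainty_equivalent_continuous (Ch n).
rewrite subspace_continuousP => /(_ x Kx) /cvgr_lt /(_ _ na) hna.
have : \forall y \near x, K y -> ce (h n) y < a by exact: hna.
apply: filterS => y yna Ky; apply: le_lt_trans (yna Ky).
apply: (power_mean_le (q y) d_neq0 eps_gt0 (Uhat_between Uv)
  (Uhat_between (Chat_Uhat (Ch n)))).
by move=> s; have /andP[] := vhB n s.
Qed.

Let agg_usc v : Uhat eps B v -> upper_semicontinuous (agg v : subspace K -> R).
Proof.
move=> Uv; apply/usc_subspaceP; apply: ces_usc => //.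
- by move=> x _; exact: ce_gt0.
- exact/usc_subspaceP.
- exact: ce_usc.
Qed.

Let agg_bounds v x : Uhat eps B v -> K x -> eps <= agg v x <= B.
Proof.
move=> Uv Kx; apply: (@ces_bounds _ _ _ _ _ _ b0 b1) => //; first exact: u_bounds.
exact: ce_between.
Qed.

Let inK s a : xsection K s a -> K (s, a).
Proof. by rewrite /xsection/= inE. Qed.

Let bellman_max v : Uhat eps B v ->
  forall s, is_max [set agg v (s, a) | a in xsection K s] (bellman v s).
Proof.
move=> Uv s.
have [a Ka amax] : exists2 a, xsection K s a &
    forall a', xsection K s a' -> agg v (s, a') <= agg v (s, a).
  apply: (@usc_compact_max _ _ _ _ B) => //.
  - by move=> a /inK /(agg_bounds Uv)/andP[].
  - move=> a c /inK Ka ac.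
    (* A product neighbourhood of [(s, a)] is cut down to the slice over [s]. *)
    have [[V W] /= [sV aW] VW] :=
      (usc_subspaceP K (agg v)).1 (agg_usc Uv) _ _ Ka ac.
    apply: filterS aW => a' Wa' /inK Ka'.
    by apply: (VW (s, a')) => //; split=> //; exact: nbhs_singleton.
have ub : ubound [set agg v (s, a) | a in xsection K s] (agg v (s, a)).
  by move=> _ [a' Ka' <-]; exact: amax.
suff -> : bellman v s = agg v (s, a) by split=> //; exists a.
apply/le_anti/andP; split; first by apply: sup_le_ub => //; exists (agg v (s, a)), a.
by apply: ub_le_sup; [exists (agg v (s, a))|exists a].
Qed.

Let bellmanP v : Uhat eps B v ->
  bellman_solution K q u beta p d v <-> bellman v = v.
Proof.
move=> Uv; split=> [sol|bv s]; last by rewrite -{2}bv; exact: bellman_max.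
apply/funext => s; have [m1 ub1] := bellman_max Uv s.
have [m2 ub2] := sol s.
by apply/le_anti/andP; split; [exact: ub2|exact: ub1].
Qed.

Let bellman_bounds v s : Uhat eps B v -> eps <= bellman v s <= B.
Proof. by move=> Uv; have [[a /inK Ka <-] _] := bellman_max Uv s; exact: agg_bounds. Qed.

Lemma bellman_Uhat v : Uhat eps B v -> Uhat eps B (bellman v).
Proof.
move=> Uv; split=> [|s]; last exact: bellman_bounds.
exact: (maximum_usc K_compact K_usc (agg_usc Uv) (bellman_max Uv)).
Qed.

Lemma bellman_Chat v : lsc_correspondence (xsection K) ->
  {within K, continuous u} -> Chat eps B v -> Chat eps B (bellman v).
Proof.
move=> lK cu Cv; have Uv := Chat_Uhat Cv.
split=> [|s]; last exact: bellman_bounds.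
apply: usc_lsc_continuous; first by have [] := bellman_Uhat Uv.
apply: (maximum_lsc lK _ (bellman_max Uv)).
have cts_lsc (f : S * A -> R) : {within K, continuous f} ->
    forall x a, K x -> a < f x -> \forall y \near x, K y -> a < f y.
  by rewrite subspace_continuousP => cf x a Kx /(cvgr_gt _ (cf x Kx)).
apply: ces_lsc => //.
- by move=> x _; exact: ce_gt0.
- exact: cts_lsc.
- exact/cts_lsc/certainty_equivalent_continuous.
Qed.

(** The two aggregators are compared at one action, a maximizer for [v], which is also a candidate
    for [w]. *)
Lemma bellman_contraction delta c v w : 0 < delta <= 1 ->
  (forall u x, b0 <= u <= b1 -> eps <= x <= B ->
    delta * ((1 - beta) * u `^ p + beta * x `^ p) <= (1 - beta) * u `^ p) ->
  1 <= c -> Uhat eps B v -> Uhat eps B w -> (forall s, v s <= c * w s) ->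
  forall s, bellman v s <=
    (1 + (1 - delta) * (c `^ p - 1)) `^ p^-1 * bellman w s.
Proof.
move=> /andP[d0 d1] hdelta c1 Uv Uw vw s.
have c0 : 0 <= c by lra.
have [[a /inK Ka <-] _] := bellman_max Uv s.
have [_ ub] := bellman_max Uw s.
have aggvw : agg v (s, a) <=
    (1 + (1 - delta) * (c `^ p - 1)) `^ p^-1 * agg w (s, a).
  have [mv vb] := Uhat_between Uv; have [mw wb] := Uhat_between Uw.
  apply: (@le_trans _ _ (ces beta p (u (s, a)) (c * ce w (s, a)))).
    apply: ces_le => //; [exact: u_gt0|exact: ce_gt0|].
    rewrite /certainty_equivalent.
    have := power_meanZ (q (s, a)) d_neq0 eps_gt0 (Uhat_between Uw) c0.
    rewrite /power_mean => <-.
    (* [c * w] may exceed [B], so the common range is widened to [[eps, c * B]]. *)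
    apply: (@power_mean_le _ _ _ (q (s, a)) d eps (c * B)) => //.
      split=> // t; have /andP[-> vB] := vb t; rewrite (le_trans vB)//.
      by rewrite ler_peMl// (le_trans (ltW eps_gt0)).
    split; first exact: measurable_funM.
    move=> t; have /andP[w1 w2] := wb t; rewrite ler_wpM2l// andbT.
    by rewrite (le_trans w1)// ler_peMl// (le_trans (ltW eps_gt0)).
  apply: ces_scale => //; [exact: u_gt0|exact: ce_gt0|by rewrite ltW|].
  by apply: hdelta; [exact: u_bounds|exact: ce_between].
apply: (le_trans aggvw); rewrite ler_wpM2l ?powR_ge0//.
by apply: ub; exists a => //; rewrite /xsection/= inE.
Qed.

(** The class [C] is left abstract so that the same fixed point argument serves [Uhat] and
    [Chat]. *)
Lemma bellman_solution_unique_in (C : set (S -> R)) :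
  C `<=` Uhat eps B -> C !=set0 -> (forall v, C v -> C (bellman v)) ->
  (forall (c : R^nat) v, (forall n, 1 <= c n) -> c @ \oo --> (1 : R) ->
    (forall n, exists2 w, C w & forall s, v s <= c n * w s /\ w s <= c n * v s) ->
    (forall s, eps <= v s <= B) -> C v) ->
  exists v, [/\ C v, bellman_solution K q u beta p d v &
    forall w, C w -> bellman_solution K q u beta p d w -> w = v].
Proof.
move=> CU C0 Cbellman Cclosed.
have [delta delta01 hdelta] :=
  ces_share p beta_ge0 beta_lt1 b0_gt0 eps_gt0 b0_le_b1 eps_le_B.
have k01 : 0 <= 1 - delta < 1 by lra.
(* [B / eps] bounds the ratio of any two functions with values in [[eps, B]]; it is the initial
   modulus. *)
have c01 : 1 <= B / eps by rewrite ler_pdivlMr// mul1r.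
have [c [cB c1 ccvg crec]] := contraction_moduli p_neq0 k01 c01.
have := @thompson_fixpoint R S C bellman c C0; case=> //.
- by move=> v s /CU[_ /(_ s)/andP[+ _]]; exact: lt_le_trans.
- move=> v w s /CU[_ /(_ s)/andP[_ vB]] /CU[_ /(_ s)/andP[ew _]].
  apply: (le_trans vB); rewrite cB mulrAC ler_pdivlMr// ler_wpM2l//.
  exact: le_trans (ltW eps_gt0) eps_le_B.
- move=> n v w /CU Uv /CU Uw vw s; rewrite crec.
  exact: bellman_contraction.
(* The bounds survive the limit: [eps <= c n * v s] and [v s <= c n * B] for every [n]. *)
- move=> v vC; apply: (Cclosed c) => // s; apply/andP.
  split.
    have ce1 : c n * v s @[n --> \oo] --> v s.
      by rewrite -[X in _ --> X]mul1r; apply: cvgMl.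
    rewrite -(cvg_lim (@Rhausdorff R) ce1); apply: limr_ge.
      by apply/cvg_ex; exists (v s).
    apply: nearW => n; have [w /CU[_ /(_ s)/andP[ew _]] /(_ s)[_]] := vC n.
    exact: le_trans.
  have cB1 : c n * B @[n --> \oo] --> B.
    by rewrite -[X in _ --> X]mul1r; apply: cvgMl.
  rewrite -(cvg_lim (@Rhausdorff R) cB1); apply: limr_ge.
    by apply/cvg_ex; exists B.
  apply: nearW => n; have [w /CU[_ /(_ s)/andP[_ wB]] /(_ s)[h _]] := vC n.
  apply: (le_trans h); rewrite ler_wpM2l//.
  by have := c1 n; lra.
- move=> v [Cv bv uniq]; exists v; split => //; first exact/bellmanP/bv/CU.
  by move=> w Cw sw; apply: uniq => //; apply/bellmanP => //; exact: CU.
Qed.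

End BellmanOperator.

(** * Solutions of the semicontinuous and of the continuous model *)

Theorem theorem8 (R : realType) (S A : borelSpace R) (K : set (S * A))
  (q : S * A -> probability (borel S) R) (u : S * A -> R)
  (b0 b1 beta p eps B d : R)
  (K_borel : measurable (K : set (borel (S * A))))
  (K_sections : forall s : S, xsection K s !=set0)
  (q_transition : transition_probability K q)
  (u_borel : measurable_fun (K : set (borel (S * A))) u)
  (b0_gt0 : 0 < b0) (b0_lt_b1 : b0 < b1)
  (u_bounds : forall x, K x -> b0 <= u x <= b1)
  (beta_range : 0 <= beta < 1)
  (p_lt1 : p < 1) (p_neq0 : p != 0)
  (eps_gt0 : 0 < eps) (eps_lt_B : eps < B)
  (eps_B_neg : p < 0 -> eps <= b0 /\ (1 - beta) `^ p^-1 * b1 <= B)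
  (eps_B_pos : 0 < p -> eps <= (1 - beta) `^ p^-1 * b0 /\ b1 <= B)
  (d_lt1 : d < 1) (d_neq0 : d != 0) :
  ((forall s : S, compact (xsection K s)) ->
   usc_correspondence (xsection K) ->
   upper_semicontinuous (u : subspace K -> R) ->
   feller K q ->
   exists! v : S -> R, Uhat eps B v /\ bellman_solution K q u beta p d v) /\
  ((forall s : S, compact (xsection K s)) ->
   continuous_correspondence (xsection K) ->
   {within K, continuous u} ->
   feller K q ->
   exists v : S -> R,
     unique (fun w => Uhat eps B w /\ bellman_solution K q u beta p d w) v /\
     Chat eps B v).
Proof.
have [beta_ge0 beta_lt1] := andP beta_range.
have b01 := ltW b0_lt_b1; have eB := ltW eps_lt_B.
have unique_in := bellman_solution_unique_in K_sections b0_gt0 b01 u_bounds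
  beta_ge0 beta_lt1 p_neq0 eps_gt0 eB eps_B_neg eps_B_pos d_neq0.
have operator_Uhat := bellman_Uhat K_sections b0_gt0 u_bounds
  beta_ge0 beta_lt1 p_neq0 eps_gt0 eps_B_neg eps_B_pos d_neq0.
have operator_Chat := bellman_Chat K_sections b0_gt0 u_bounds
  beta_ge0 beta_lt1 p_neq0 eps_gt0 eps_B_neg eps_B_pos d_neq0.
have CU := @Chat_Uhat R S eps B.
have CB : Chat eps B (cst B : S -> R).
  by split=> [|s]; [exact: cst_continuous|rewrite /= eB lexx].
have existsU : (forall s : S, compact (xsection K s)) ->
   usc_correspondence (xsection K) ->
   upper_semicontinuous (u : subspace K -> R) -> feller K q ->
   exists v, [/\ Uhat eps B v, bellman_solution K q u beta p d v &
     forall w, Uhat eps B w -> bellman_solution K q u beta p d w -> w = v].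
  move=> cK uK uu fq; apply: (unique_in q cK uu fq (Uhat eps B)) => //.
  - by exists (cst B); exact: CU.
  - by move=> v; exact: (operator_Uhat q cK uK uu fq).
  - move=> c v c1 ccvg vw vb; split=> //; apply: (usc_ratio_limit c1 ccvg) => n.
    by have [w [uw _] h] := vw n; exists w.
split=> [cK uK uu fq|cK [uK lK] cu fq].
  have [v [Uv sv uniq]] := existsU cK uK uu fq.
  by exists v; split=> // w [Uw sw]; rewrite (uniq w).
have uu : upper_semicontinuous (u : subspace K -> R).
  by move=> x a uxa; have /cvgr_lt := cu x; exact.
have [v [Uv sv uniq]] := existsU cK uK uu fq.
(* The fixed point argument inside [Chat] yields a continuous solution, which uniqueness in the
   larger class [Uhat] identifies with [v]. *)
have [w [Cw sw _]] : exists v, [/\ Chat eps B v,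
    bellman_solution K q u beta p d v & forall w, Chat eps B w ->
      bellman_solution K q u beta p d w -> w = v].
  apply: (unique_in q cK uu fq (Chat eps B)) => //.
  - by exists (cst B).
  - by move=> w; exact: (operator_Chat q cK uK uu fq).
  - move=> c w c1 ccvg wv wb; split=> //; apply: usc_lsc_continuous.
      apply: (usc_ratio_limit c1 ccvg) => n.
      by have [z /CU[uz _] h] := wv n; exists z.
    apply: (lsc_ratio_limit c1 ccvg) => n.
    have [z [cz _] h] := wv n; exists z => // x a; exact: (cvgr_gt _ (cz x)).
have wv : w = v by apply: uniq => //; exact: CU.
exists v; split; last by rewrite -wv.
by split=> // z [Uz sz]; rewrite (uniq z).
Qed.
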